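(* Let $\lambda$ be a non-zero real number. For all integers $r>n\ge 0$, $$H_{n,\lambda}(x)=\sum_{k=0}^{n}\frac{1}{k!}\Bigg\{\sum_{j=0}^{k}\sum_{l=0}^{n}\frac{2^{l}\binom{n}{l}\binom{k}{j}}{\binom{l+r-k}{l}}\,S_{2,\lambda}(l+r-k,r-k)\,(-1)^{k-j}H_{n-l,\lambda}(j)\Bigg\}\beta_{k,\lambda}^{(r)}(x),$$ where $H_{n,\lambda}(x)$ are the degenerate Hermite polynomials, $\beta_{k,\lambda}^{(r)}(x)$ are the degenerate Bernoulli polynomials of order $r$, and $S_{2,\lambda}(n,l)$ are the degenerate Stirling numbers of the second kind.
   Context: Fix a non-zero real number $\lambda$. Put $(x)_{0}=1$, $(x)_n=x(x-1)\cdots(x-n+1)$ for $n\ge1$, and $(x)_{0,\lambda}=1$, $(x)_{n,\lambda}=x(x-\lambda)\cdots(x-(n-1)\lambda)$ for $n\ge 1$. The degenerate exponential functions are $e_\lambda^x(t)=(1+\lambda t)^{x/\lambda}=\sum_{n\ge 0}(x)_{n,\lambda}\frac{t^n}{n!}$, regarded as formal power series in $t$, and $e_\lambda(t)=e_\lambda^1(t)$. The degenerate Hermite polynomials $H_{n,\lambda}(x)$ are defined by $$e_\lambda^{-1}(t^2)\, e_\lambda^{x}(2t)=\sum_{n=0}^\infty H_{n,\lambda}(x)\frac{t^n}{n!}.$$ The degenerate Bernoulli polynomials of order $r$ (a positive integer) are defined by $$\bigg(\frac{t}{e_\lambda(t)-1}\bigg)^{r}e_\lambda^x(t)=\sum_{n=0}^\infty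 \beta_{n,\lambda}^{(r)}(x)\frac{t^n}{n!}.$$ The degenerate Stirling numbers of the second kind $S_{2,\lambda}(n,l)$ are defined by $$(x)_{n,\lambda}=\sum_{l=0}^{n}S_{2,\lambda}(n,l)\,(x)_{l},\qquad n\ge 0.$$ *)

(* Defs.v *)
From mathcomp Require Import all_boot all_order all_algebra.
From mathcomp Require Import boolp reals.

Set Implicit Arguments.
Unset Strict Implicit.
Unset Printing Implicit Defensive.

Import GRing.Theory.

Local Open Scope ring_scope.

(* A formal power series [\sum_n f n * t ^ n] over [K] is represented by its
   sequence of coefficients [f : nat -> K]. *)
Section FormalPowerSeries.
Variable K : comUnitRingType.
Implicit Types f g : nat -> K.

Definition fps_one : nat -> K := fun n => (n == 0%N)%:R.

Definition fps_t : nat -> K := fun n => (n == 1%N)%:R.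

Definition fps_mul f g : nat -> K :=
  fun n => \sum_(i < n.+1) f i * g (n - i)%N.

Definition fps_exp f (m : nat) : nat -> K := iter m (fps_mul f) fps_one.

(* The substitution [f (g t)], meaningful when [g 0 = 0]: then [g ^ k] has no
   term of degree [< k], so the sum over [k <= n] is the whole coefficient. *)
Definition fps_comp f g : nat -> K :=
  fun n => \sum_(k < n.+1) f k * fps_exp g k n.

Fixpoint fps_inv_seq f (n : nat) : seq K :=
  if n is m.+1 then
    let s := fps_inv_seq f m in
    rcons s (((m == 0%N)%:R - \sum_(i < m) f (m - i)%N * s`_i) / f 0%N)
  else [::].

(* The multiplicative inverse of [f], meaningful when [f 0] is a unit. *)
Definition fps_inv f : nat -> K := fun n => (fps_inv_seq f n.+1)`_n.

(* The quotient [t / f], for [f] with [f 0 = 0] and [f 1] a unit: both sides of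
   the fraction are divided by [t] first. *)
Definition fps_t_div f : nat -> K := fps_inv (fun n => f n.+1).

Lemma size_fps_inv_seq f n : size (fps_inv_seq f n) = n.
Proof. by elim: n => //= n IH; rewrite size_rcons IH. Qed.

Lemma nth_fps_inv_seq f n i : (i < n)%N -> (fps_inv_seq f n)`_i = fps_inv f i.
Proof.
elim: n => // n IH; rewrite ltnS leq_eqVlt => /orP[/eqP -> //|lt_in].
by rewrite /= nth_rcons size_fps_inv_seq lt_in IH.
Qed.

Lemma fps_mulV f : f 0%N \is a GRing.unit -> fps_mul (fps_inv f) f =1 fps_one.
Proof.
move=> Uf n; rewrite /fps_mul big_ord_recr /= subnn.
rewrite {2}/fps_inv /= nth_rcons size_fps_inv_seq ltnn eqxx divrK //.
rewrite addrC; under eq_bigr => i _ do rewrite nth_fps_inv_seq // mulrC.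
by rewrite subrK.
Qed.

Lemma fps_t_divK f : f 0%N = 0 -> f 1%N \is a GRing.unit ->
  fps_mul (fps_t_div f) f =1 fps_t.
Proof.
move=> f0 Uf n; rewrite /fps_mul big_ord_recr /= subnn f0 mulr0 addr0.
case: n => [|n]; first by rewrite big_ord0.
rewrite -[RHS](fps_mulV (f := fun n => f n.+1) Uf n).
by apply: eq_bigr => i _; rewrite subSn // -ltnS.
Qed.

End FormalPowerSeries.

Arguments fps_one {K}.
Arguments fps_t {K}.

Section DegenerateExponential.
Variable K : comUnitRingType.
Implicit Types lam x : K.

(* [(x)_n] *)
Definition fall x (n : nat) : K := \prod_(i < n) (x - i%:R).

(* [(x)_{n, lam}] *)
Definition dfall lam x (n : nat) : K := \prod_(i < n) (x - i%:R * lam).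

(* [e_lam^x(t)]; it is only used over rings where every [n`!] is a unit. *)
Definition dexp lam x : nat -> K := fun n => dfall lam x n / n`!%:R.

End DegenerateExponential.

Section DegeneratePolynomials.
Variable R : realType.
Implicit Types lam : R.

(* The generating functions are power series in [t] over [{poly R}], the
   polynomial indeterminate ['X] playing the role of [x]. *)

Definition degHermite_gf lam : nat -> {poly R} :=
  fps_mul (fps_comp (dexp lam%:P (-1)) (fps_exp fps_t 2))
          (fps_comp (dexp lam%:P 'X) (fun n => 2 * fps_t n)).

Definition degHermite lam (n : nat) : {poly R} :=
  n`!%:R * degHermite_gf lam n.

Definition degBernoulli_gf (r : nat) lam : nat -> {poly R} :=
  fps_mul
    (fps_exp (fps_t_div (fun n => dexp lam%:P 1 n - fps_one n)) r)
    (dexp lam%:P 'X).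

Definition degBernoulli (r : nat) lam (n : nat) : {poly R} :=
  n`!%:R * degBernoulli_gf r lam n.

Lemma dexp_sub1_t_divK lam :
  let E n := dexp lam%:P 1 n - fps_one n in
  fps_mul (fps_t_div E) E =1 fps_t.
Proof.
apply: fps_t_divK.
  by rewrite /dexp /dfall big_ord0 divr1 subrr.
by rewrite /dexp /dfall /fps_one big_ord1 mul0r !subr0 divr1 unitr1.
Qed.

Lemma degStirling2_exists lam (n : nat) :
  exists s : nat -> R, dfall lam%:P 'X n = \sum_(l < n.+1) s l *: fall 'X l.
Proof.
elim: n => [|n [s IH]].
  by exists (fun=> 1); rewrite big_ord1 scale1r /dfall /fall !big_ord0.
exists (fun l => (if l is l'.+1 then s l' else 0)
                 + (if (l <= n)%N then (l%:R - n%:R * lam) * s l else 0)).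
rewrite /dfall big_ord_recr /= -/(dfall _ _ n) IH.
under [RHS]eq_bigr => l _ do rewrite scalerDl.
rewrite big_split /= [X in _ = X + _]big_ord_recl /= scale0r add0r.
rewrite [X in _ = _ + X]big_ord_recr /= ltnn scale0r addr0 mulr_suml -big_split.
apply: eq_bigr => /= l _; rewrite -ltnS ltn_ord /bump /= add1n.
rewrite {2}/fall big_ord_recr /= -/(fall _ l).
have -> : 'X - n%:R * lam%:P = ('X - l%:R) + (l%:R - n%:R * lam)%:P :> {poly R}.
  by rewrite polyCB polyCM !polyC_natr addrA subrK.
by rewrite mulrDr -!scalerAl [X in _ + _ *: X]mulrC mul_polyC scalerA [s l * _]mulrC.
Qed.

(* [S_{2, lam}(n, l)] for [l <= n]: the coordinates of [(x)_{n, lam}] in the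
   basis of falling factorials. Values for [l > n] are unspecified. *)
Definition degStirling2 lam (n : nat) : nat -> R :=
  projT1 (cid (degStirling2_exists lam n)).

Lemma degStirling2P lam (n : nat) :
  dfall lam%:P 'X n = \sum_(l < n.+1) degStirling2 lam n l *: fall 'X l.
Proof. exact: projT2 (cid (degStirling2_exists lam n)). Qed.

Lemma fall_basis_inj (n : nat) (s s' : nat -> R) :
  \sum_(l < n) s l *: fall 'X l = \sum_(l < n) s' l *: fall 'X l ->
  forall l, (l < n)%N -> s l = s' l.
Proof.
have fallE l : fall 'X l = \prod_(i < l) ('X - (i%:R)%:P) :> {poly R}.
  by apply: eq_bigr => i _; rewrite polyC_natr.
have szf l : size (fall 'X l : {poly R}) = l.+1.
  by rewrite fallE size_prod_XsubC /index_enum -enumT size_enum_ord.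
have mon l : (fall 'X l : {poly R})`_l = 1.
  have /eqP := monic_prod_XsubC (index_enum 'I_l) xpredT (fun i => i%:R : R).
  by rewrite -fallE /lead_coef szf.
have hi m (c : nat -> R) : (\sum_(l < m) c l *: fall 'X l)`_m = 0.
  rewrite coef_sum big1 // => l _.
  by rewrite coefZ [X in _ * X]nth_default ?mulr0 // szf.
elim: n => // n IH; rewrite !big_ord_recr /= => eqS.
have en : s n = s' n.
  by have := congr1 (coefp n) eqS; rewrite /= !coefD !hi !coefZ !mon !mulr1 !add0r.
move=> l; rewrite ltnS leq_eqVlt => /orP[/eqP -> //|]; apply: IH.
by move: eqS; rewrite en => /addIr.
Qed.

Lemma degStirling2_unique lam (n : nat) (s : nat -> R) :
  dfall lam%:P 'X n = \sum_(l < n.+1) s l *: fall 'X l ->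
  forall l, (l <= n)%N -> s l = degStirling2 lam n l.
Proof.
move=> sP l le_ln; apply: (@fall_basis_inj n.+1) => //.
by rewrite -sP -degStirling2P.
Qed.

End DegeneratePolynomials.

(* Main.v *)
(* Write E = e_lam(t), E - 1 = t q and A = e_lam^{-1}(t^2). The Bernoulli
   generating function is B = q^{-r} E^x, so E^x = q^r B, and the Hermite one is
   A(t) E^x(2t) = A(t) q(2t)^r B(2t). Hence the coefficient of beta_k / k! in
   H_n / n! is 2^k [t^{n-k}] A(t) q(2t)^r = [t^n] A(t) (t^k q^r)(2t). For k <= r,
   t^k q^r = (E - 1)^k q^{r-k}: the first factor is a signed binomial sum of powers
   E^j, which turn A into Hermite polynomials at j, and the coefficients of the
   second are Stirling numbers, as (E - 1)^m / m! = sum_n S_2(n, m) t^n / n!. *)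
Require Import Defs.
From HB Require Import structures.
From mathcomp Require Import all_boot all_order all_algebra.
From mathcomp Require Import boolp reals ring.

Import GRing.Theory.

Set Implicit Arguments.
Unset Strict Implicit.
Unset Printing Implicit Defensive.

Local Open Scope ring_scope.

(* An alias of [nat -> K], so that the Cauchy product does not clash with
   pointwise structures on functions. *)
Definition fps (K : comUnitRingType) : Type := nat -> K.

(** * The commutative ring of formal power series *)

Section FpsRing.
Variable K : comUnitRingType.
Implicit Types f g h : fps K.

(** A coefficient of a Cauchy product only involves coefficients of lower or equal index.
    Associativity and commutativity are thus inherited from truncations to polynomials. *)
Lemma fps_mul_poly (p q : {poly K}) f g n :
    (forall i, (i <= n)%N -> p`_i = f i) -> (forall i, (i <= n)%N -> q`_i = g i) ->
  (p * q)`_n = fps_mul f g n.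
Proof.
move=> pf qg; rewrite coefM; apply: eq_bigr => i _.
by rewrite pf -1?ltnS // qg ?leq_subr.
Qed.

Let trunc n f : {poly K} := \poly_(i < n.+1) f i.

Let truncE n f i : (i <= n)%N -> (trunc n f)`_i = f i.
Proof. by rewrite coef_poly ltnS => ->. Qed.

Let truncM n f g i : (i <= n)%N -> (trunc n f * trunc n g)`_i = fps_mul f g i.
Proof.
by move=> le_in; apply: fps_mul_poly => j le_ji; apply/truncE/(leq_trans le_ji).
Qed.

Let fps_addA : associative (fun f g : fps K => (fun n => f n + g n) : fps K).
Proof. by move=> f g h; apply/funext => n; rewrite addrA. Qed.

Let fps_addC : commutative (fun f g : fps K => (fun n => f n + g n) : fps K).
Proof. by move=> f g; apply/funext => n; rewrite addrC. Qed.

Let fps_add0 : left_id ((fun=> 0) : fps K)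
  (fun f g : fps K => (fun n => f n + g n) : fps K).
Proof. by move=> f; apply/funext => n; rewrite add0r. Qed.

Let fps_addN : left_inverse ((fun=> 0) : fps K) (fun f => (fun n => - f n) : fps K)
  (fun f g : fps K => (fun n => f n + g n) : fps K).
Proof. by move=> f; apply/funext => n; rewrite addNr. Qed.

HB.instance Definition _ := gen_eqMixin (fps K).
HB.instance Definition _ := gen_choiceMixin (fps K).
HB.instance Definition _ :=
  GRing.isZmodule.Build (fps K) fps_addA fps_addC fps_add0 fps_addN.

Let fps_mulA : associative (@fps_mul K : fps K -> fps K -> fps K).
Proof.
move=> f g h; apply/funext => n.
rewrite -(@fps_mul_poly (trunc n f) (trunc n g * trunc n h)) //; first last.
- exact: truncM.
- exact: truncE.
by rewrite mulrA; apply: fps_mul_poly; [exact: truncM|exact: truncE].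
Qed.

Let fps_mulC : commutative (@fps_mul K : fps K -> fps K -> fps K).
Proof. by move=> f g; apply/funext => n; rewrite -!(@truncM n) // mulrC. Qed.

Let fps_mul1 : left_id (fps_one : fps K) (@fps_mul K : fps K -> fps K -> fps K).
Proof.
move=> f; apply/funext => n; rewrite /fps_mul big_ord_recl /= subn0 mul1r.
by rewrite big1 ?addr0 // => i _; rewrite mul0r.
Qed.

Let fps_mulDl : left_distributive (@fps_mul K : fps K -> fps K -> fps K) +%R.
Proof.
move=> f g h; apply/funext => n; rewrite /fps_mul -[RHS]big_split.
by apply: eq_bigr => i _; rewrite mulrDl.
Qed.

Let fps_one_neq0 : (fps_one : fps K) != 0.
Proof.
by apply/eqP => /(congr1 (fun f : fps K => f 0%N)) /eqP; rewrite /fps_one oner_eq0.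
Qed.

HB.instance Definition _ := GRing.Zmodule_isComNzRing.Build (fps K)
  fps_mulA fps_mulC fps_mul1 fps_mulDl fps_one_neq0.

Lemma fpsME f g n : (f * g) n = \sum_(i < n.+1) f i * g (n - i)%N.
Proof. by []. Qed.

Lemma fps_sumE (I : Type) (s : seq I) (P : pred I) (F : I -> fps K) n :
  (\sum_(i <- s | P i) F i) n = \sum_(i <- s | P i) F i n.
Proof. by elim/big_rec2: _ => // i x y _ <-. Qed.

Lemma fps_mulrnE f m n : (f *+ m) n = f n *+ m.
Proof. by elim: m => // m IH; rewrite !mulrS -IH. Qed.

Lemma fps_expE f m : fps_exp f m = f ^+ m :> fps K.
Proof. by elim: m => // m IH; rewrite exprS -IH. Qed.

Lemma fps_mul_tE f n : ((fps_t : fps K) * f) n = if n is n'.+1 then f n' else 0.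
Proof.
case: n => [|n]; first by rewrite fpsME big_ord1 mul0r.
rewrite fpsME 2!big_ord_recl mul0r add0r mul1r subSS subn0 big1 ?addr0 //.
by move=> i _; rewrite mul0r.
Qed.

Lemma fps_mul_tXE f k n : ((fps_t : fps K) ^+ k * f) (k + n)%N = f n.
Proof. by elim: k => [|k IH]; rewrite ?mul1r // exprS -mulrA fps_mul_tE. Qed.

Lemma fps_tXE k n : ((fps_t : fps K) ^+ k) n = (n == k)%:R.
Proof. by elim: k n => [|k IH] [|n] //; rewrite exprS fps_mul_tE. Qed.

(** The substitution f(a t), in a form that is visibly a ring morphism. *)
Definition fps_scale (a : K) f : fps K := fun n => a ^+ n * f n.

Variable a : K.

Let fps_scaleB : zmod_morphism (fps_scale a).
Proof. by move=> f g; apply/funext => n; rewrite /fps_scale mulrBr. Qed.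

Let fps_scaleM : monoid_morphism (fps_scale a).
Proof.
split=> [|f g]; apply/funext => n.
  by rewrite /fps_scale; case: n => [|n]; rewrite ?mul1r // [LHS]mulr0.
rewrite /fps_scale !fpsME mulr_sumr; apply: eq_bigr => i _.
by rewrite mulrACA -exprD subnKC // -ltnS.
Qed.

HB.instance Definition _ :=
  GRing.isZmodMorphism.Build (fps K) (fps K) (fps_scale a) fps_scaleB.
HB.instance Definition _ :=
  GRing.isMonoidMorphism.Build (fps K) (fps K) (fps_scale a) fps_scaleM.

Lemma fps_comp_scale f : fps_comp f (fun n => a * fps_t n) = fps_scale a f.
Proof.
apply/funext => n.
have expE k m : fps_exp (fun n => a * fps_t n) k m = a ^+ k * (m == k)%:R.
  rewrite -fps_tXE fps_expE.
  have -> : ((fun n => a * fps_t n) : fps K) = fps_scale a fps_t.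
    by apply/funext => -[|[|i]]; rewrite /fps_scale ?expr1 // !mulr0.
  rewrite -rmorphXn /= /fps_scale fps_tXE.
  by case: eqP => [->|_]; rewrite ?mulr1 ?mulr0.
(* Only k = n contributes, since (a t)^k is concentrated in degree k. *)
rewrite /fps_comp big_ord_recr big1 /= => [|k _].
  by rewrite expE eqxx mulr1 add0r mulrC.
by rewrite expE gtn_eqF ?mulr0.
Qed.

End FpsRing.

(** * Coefficientwise base change of power series *)

Section FpsMap.
Variables (K L : comUnitRingType) (phi : {rmorphism K -> L}).

Definition fps_map (f : fps K) : fps L := fun n => phi (f n).

Let fps_mapB : zmod_morphism fps_map.
Proof. by move=> f g; apply/funext => n; rewrite /fps_map rmorphB. Qed.

Let fps_mapM : monoid_morphism fps_map.
Proof.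
split=> [|f g]; apply/funext => n; first by rewrite /fps_map rmorph_nat.
rewrite /fps_map !fpsME rmorph_sum; apply: eq_bigr => i _.
by rewrite rmorphM.
Qed.

HB.instance Definition _ :=
  GRing.isZmodMorphism.Build (fps K) (fps L) fps_map fps_mapB.
HB.instance Definition _ :=
  GRing.isMonoidMorphism.Build (fps K) (fps L) fps_map fps_mapM.

Lemma fps_map_t : fps_map fps_t = fps_t.
Proof. by apply/funext => n; rewrite /fps_map rmorph_nat. Qed.

Lemma fps_map_scale a f : fps_map (fps_scale a f) = fps_scale (phi a) (fps_map f).
Proof. by apply/funext => n; rewrite /fps_map /fps_scale rmorphM rmorphXn. Qed.

Lemma fps_map_exp f m : fps_map (fps_exp f m) = fps_exp (fps_map f) m.
Proof. by rewrite !fps_expE -(rmorphXn fps_map). Qed.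

Lemma fps_map_comp f g : fps_map (fps_comp f g) = fps_comp (fps_map f) (fps_map g).
Proof.
apply/funext => n; rewrite /fps_map rmorph_sum; apply: eq_bigr => k _.
by rewrite rmorphM -fps_map_exp.
Qed.

Lemma fps_map_dexp lam x : (forall n, n`!%:R \is a @GRing.unit K) ->
  fps_map (dexp lam x) = dexp (phi lam) (phi x).
Proof.
move=> Uf; apply/funext => n; rewrite /fps_map /dexp rmorph_div // rmorph_nat.
rewrite rmorph_prod; congr (_ / _); apply: eq_bigr => i _.
by rewrite rmorphB rmorphM rmorph_nat.
Qed.

End FpsMap.

(** * Degenerate exponentials in characteristic zero *)

Section DegenerateExponentialTheory.
Variable F : numFieldType.
Implicit Types lam x y : F.

Lemma dexp0E lam x : dexp lam x 0 = 1.
Proof. by rewrite /dexp /dfall big_ord0 divr1. Qed.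

Lemma factF_neq0 n : n`!%:R != 0 :> F.
Proof. by rewrite Num.Theory.pnatr_eq0 -lt0n fact_gt0. Qed.

(* The differential equation [(1 + lam t) f' = x f], coefficientwise. *)
Lemma dexpSE lam x n : n.+1%:R * dexp lam x n.+1 = (x - n%:R * lam) * dexp lam x n.
Proof.
have n1 : n.+1%:R != 0 :> F by rewrite Num.Theory.pnatr_eq0.
rewrite /dexp /dfall big_ord_recr /= factS natrM.
by field; rewrite factF_neq0 -mulrS n1.
Qed.

(** Both sides have constant term 1 and solve (1 + lam t) f' = (x + y) f, which determines all
    coefficients by recursion. *)
Lemma dexpD lam x y :
  dexp lam (x + y) = (dexp lam x : fps F) * dexp lam y :> fps F.
Proof.
apply/funext => n; elim: n => [|n IH]; first by rewrite fpsME big_ord1 !dexp0E mulr1.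
have n1 : n.+1%:R != 0 :> F by rewrite Num.Theory.pnatr_eq0.
apply: (mulfI n1); rewrite dexpSE {}IH !fpsME.
set f := dexp lam x; set g := dexp lam y.
(* Leibniz rule: the factor n + 1 is split as i + (n + 1 - i). *)
transitivity (\sum_(i < n.+2) i%:R * f i * g (n.+1 - i)%N
            + \sum_(i < n.+2) f i * ((n.+1 - i)%:R * g (n.+1 - i)%N)); last first.
  rewrite -big_split mulr_sumr; apply: eq_bigr => /= i _.
  by rewrite natrB -1?ltnS //; ring.
(* The term i = 0 of the first sum and the term i = n + 1 of the second vanish. After a shift of the
   first, the factors add up: (x - i lam) + (y - (n - i) lam) = x + y - n lam. *)
rewrite [X in _ = X + _]big_ord_recl [X in _ = _ + X]big_ord_recr /= subnn !mul0r mulr0.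
rewrite add0r addr0 -big_split mulr_sumr; apply: eq_bigr => /= i _.
have le_in : (i <= n)%N by rewrite -ltnS.
rewrite /bump add1n subSS dexpSE subSn // dexpSE -/f -/g.
by rewrite natrB //; ring.
Qed.

Lemma dexp_nat lam j : dexp lam j%:R = (dexp lam 1 : fps F) ^+ j :> fps F.
Proof.
elim: j => [|j IH]; last by rewrite exprS -IH -dexpD mulrS.
apply/funext => -[|n]; first exact: dexp0E.
by rewrite /dexp /dfall big_ord_recl mul0r subr0 !mul0r.
Qed.

End DegenerateExponentialTheory.

(** * Falling factorials and polynomial identities at natural numbers *)

Lemma fall_nat (K : comUnitRingType) j l : fall j%:R l = ('C(j, l) * l`!)%:R :> K.
Proof.
elim: l => [|l IH]; first by rewrite bin0 /fall big_ord0.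
rewrite /fall big_ord_recr /= -/(fall _ _) IH !bin_ffact ffactnSr natrM.
(* For j < l the truncated j - l is not the difference in [K], but the falling factorial in front of
   it is already 0. *)
by case: (leqP l j) => [le_lj|lt_jl]; [rewrite natrB|rewrite ffact_small ?mul0r].
Qed.

Lemma horner_fall (K : idomainType) (x : K) l : (fall 'X l).[x] = fall x l.
Proof.
rewrite horner_prod; apply: eq_bigr => i _.
by rewrite -polyC_natr !hornerE.
Qed.

Lemma horner_dfall (K : idomainType) (lam x : K) l :
  (dfall lam%:P 'X l).[x] = dfall lam x l.
Proof.
rewrite horner_prod; apply: eq_bigr => i _.
by rewrite -polyC_natr !hornerE.
Qed.

(** The difference would have more distinct roots than its degree allows, as naturals stay distinct
    in characteristic zero. *)
Lemma poly_eq_nat (F : numFieldType) (p q : {poly F}) :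
  (forall j, p.[j%:R] = q.[j%:R]) -> p = q.
Proof.
move=> pq; apply/eqP; rewrite -subr_eq0; apply/eqP.
apply: (@roots_geq_poly_eq0 _ _ [seq i%:R | i <- iota 0 (size (p - q))]).
- by apply/allP => _ /mapP[j _ ->]; rewrite rootE hornerD hornerN pq subrr.
- rewrite map_inj_uniq ?iota_uniq // => i j /eqP.
  by rewrite Num.Theory.eqr_nat => /eqP.
- by rewrite size_map size_iota.
Qed.

(** * Stirling coefficients and the Hermite-Bernoulli connection *)

Section HermiteBernoulli.
Variables (R : realType) (lam : R).

Definition dexp_sub1 : fps R := (dexp lam 1 : fps R) - 1.

Definition dexp_sub1_div_t : fps R := fun n => dexp_sub1 n.+1.

Lemma dexp_sub1E : dexp_sub1 = (fps_t : fps R) * dexp_sub1_div_t.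
Proof.
apply/funext => -[|n]; rewrite fps_mul_tE //.
by rewrite /dexp_sub1 [LHS](_ : _ = dexp lam 1 0 - 1) // dexp0E subrr.
Qed.

Lemma dexp_sub1X_div_t m n :
  (dexp_sub1 ^+ m) (m + n)%N = (dexp_sub1_div_t ^+ m) n.
Proof. by rewrite dexp_sub1E exprMn fps_mul_tXE. Qed.

Lemma dexp_sub1X_small m n : (n < m)%N -> (dexp_sub1 ^+ m) n = 0.
Proof.
move=> lt_nm; rewrite dexp_sub1E exprMn fpsME big1 // => i _.
by rewrite fps_tXE ltn_eqF ?mul0r // (leq_ltn_trans _ lt_nm) // -ltnS.
Qed.

(* Newton expansion: [E ^ j = (1 + (E - 1)) ^ j] with [E = e_lam(t)] gives, at all
   natural [j], the expansion of [(j)_{n, lam}] in falling factorials. *)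
Lemma degStirling2E n l : (l <= n)%N ->
  degStirling2 lam n l = n`!%:R / l`!%:R * (dexp_sub1 ^+ l) n.
Proof.
move=> le_ln; symmetry; move: l le_ln.
apply: (degStirling2_unique (s := fun l => n`!%:R / l`!%:R * (dexp_sub1 ^+ l) n)).
apply: poly_eq_nat => j; rewrite horner_dfall horner_sum.
have -> : dfall lam j%:R n = n`!%:R * dexp lam j%:R n.
  by rewrite /dexp mulrC divfK // factF_neq0.
rewrite dexp_nat.
have -> : (dexp lam 1 : fps R) = 1 + dexp_sub1 by rewrite addrC subrK.
rewrite exprDn fps_sumE mulr_sumr.
pose G l := n`!%:R * ('C(j, l)%:R * (dexp_sub1 ^+ l) n).
rewrite (eq_bigr (fun l : 'I_j.+1 => G l)) => [|l _]; last first.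
  by rewrite expr1n mul1r fps_mulrnE -[_ *+ 'C(_, _)]mulr_natl.
rewrite [RHS](eq_bigr (fun l : 'I_n.+1 => G l)) => [|l _]; last first.
  rewrite hornerZ horner_fall fall_nat natrM /G.
  by field; rewrite factF_neq0.
(* One sum stops at j, the other at n. Both extend to a common range, because [G l] vanishes beyond
   either bound: the binomial for l > j, the coefficient of (E - 1)^l for l > n. *)
rewrite !(@big_ord_widen _ _ _ _ (n + j).+1 G) ?ltnS ?leq_addr ?leq_addl //.
rewrite big_mkcond [RHS]big_mkcond; apply: eq_bigr => l _ /=; rewrite !ltnS.
rewrite /G; case: (leqP l j) => lj; case: (leqP l n) => ln //.
  by rewrite dexp_sub1X_small ?mulr0.
by rewrite bin_small // mul0r mulr0.
Qed.

(** The binomial turns the factor (l + m)! / m! into l!, and (E - 1)^m = t^m q^m shifts the degree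
    by m. *)
Lemma degStirling2_div_t l m :
  degStirling2 lam (l + m) m / 'C(l + m, l)%:R = l`!%:R * (dexp_sub1_div_t ^+ m) l.
Proof.
rewrite degStirling2E ?leq_addl // [X in (dexp_sub1 ^+ _) X]addnC dexp_sub1X_div_t.
have := bin_fact (leq_addr m l); rewrite addKn => /(congr1 (GRing.natmul (1 : R))).
rewrite !natrM => <-.
have bn0 : 'C(l + m, l)%:R != 0 :> R.
  by rewrite Num.Theory.pnatr_eq0 -lt0n bin_gt0 leq_addr.
by field; rewrite bn0 factF_neq0.
Qed.

(** The series A, taken over [R] because it does not involve x. *)
Definition hermite_factor : fps R := fps_comp (dexp lam (-1)) (fps_exp fps_t 2).

Lemma fact_poly_unit n : n`!%:R \is a @GRing.unit {poly R}.
Proof.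
by rewrite -polyC_natr poly_unitE size_polyC coefC eqxx factF_neq0 unitfE factF_neq0.
Qed.

Lemma fact_unit n : n`!%:R \is a @GRing.unit R.
Proof. by rewrite unitfE factF_neq0. Qed.

Lemma degHermite_gfE : degHermite_gf lam =
  fps_map polyC hermite_factor * fps_scale 2 (dexp lam%:P 'X) :> fps {poly R}.
Proof.
rewrite /degHermite_gf fps_comp_scale; congr (fps_mul _ _).
rewrite fps_map_comp fps_map_exp fps_map_t.
by rewrite (fps_map_dexp polyC _ _ fact_unit) /= polyCN polyC1.
Qed.

(** Evaluation at x = j acts on coefficients as a ring morphism; it fixes A and sends e_lam^x(2t) to
    E(2t)^j. *)
Lemma horner_degHermite n j : (degHermite lam n).[j%:R] =
  n`!%:R * (hermite_factor * fps_scale 2 (dexp lam 1 : fps R) ^+ j) n.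
Proof.
rewrite /degHermite hornerM -polyC_natr hornerC; congr (_ * _).
rewrite degHermite_gfE -[LHS]/(fps_map (horner_eval j%:R) _ n) rmorphM.
rewrite -rmorphXn -dexp_nat; congr ((_ * _ : fps R) n).
  by apply/funext => i; rewrite /= /fps_map /horner_eval hornerC.
rewrite /= fps_map_scale (fps_map_dexp _ _ _ fact_poly_unit) /= /horner_eval.
by rewrite hornerC hornerX -[2]polyC_natr hornerC.
Qed.

Lemma dexpX_degBernoulli_gf r : dexp lam%:P 'X =
  fps_map polyC (dexp_sub1_div_t ^+ r) * degBernoulli_gf r lam :> fps {poly R}.
Proof.
rewrite /degBernoulli_gf fps_expE.
set u := fps_t_div _; rewrite -[fps_mul _ _]/((u : fps {poly R}) ^+ r * dexp lam%:P 'X).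
rewrite rmorphXn mulrA -exprMn.
suff -> : fps_map polyC dexp_sub1_div_t * (u : fps {poly R}) = 1.
  by rewrite expr1n mul1r.
have E1 : fps_map polyC (dexp lam 1) = dexp lam%:P 1.
  by rewrite (fps_map_dexp polyC _ _ fact_unit) /= polyC1.
(* This shifted series is exactly the one that [fps_t_div] inverts, and its constant coefficient is
   1. *)
have eE : fps_map polyC dexp_sub1_div_t = (fun n => dexp lam%:P 1 n.+1 - fps_one n.+1).
  apply/funext => n; rewrite -E1 /fps_map.
  by rewrite -[dexp_sub1_div_t n]/(dexp lam 1 n.+1 - 0) !subr0.
rewrite mulrC eE; apply/funext => n; apply: fps_mulV.
rewrite -E1 /fps_map /fps_one subr0 /dexp /dfall big_ord1 mul0r subr0 divr1 /=.
by rewrite polyC1 unitr1.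
Qed.

Lemma degHermite_gf_Bernoulli r : degHermite_gf lam =
  fps_scale 2 (degBernoulli_gf r lam : fps {poly R})
  * fps_map polyC (hermite_factor * fps_scale 2 (dexp_sub1_div_t ^+ r))
  :> fps {poly R}.
Proof.
rewrite degHermite_gfE (dexpX_degBernoulli_gf r).
move: (degBernoulli_gf r lam) => B.
by rewrite !rmorphM /= fps_map_scale /= polyC_natr mulrA mulrC.
Qed.

(** Both sides are n! times the coefficient of t^n in q(2t)^(r-k) A(t) (E(2t) - 1)^k. The sum over l
    is a Cauchy product, the sum over j a binomial expansion; the right side comes from E(2t) - 1 =
    2t q(2t). *)
Lemma degHermite_coord r n k : (k <= n)%N -> (k <= r)%N ->
  \sum_(j < k.+1) \sum_(l < n.+1)
    (2 ^+ l * 'C(n, l)%:R * 'C(k, j)%:R) / 'C(l + r - k, l)%:R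
    * degStirling2 lam (l + r - k) (r - k) * (-1) ^+ (k - j)
    * (degHermite lam (n - l)).[j%:R]
  = n`!%:R * 2 ^+ k * (hermite_factor * fps_scale 2 (dexp_sub1_div_t ^+ r)) (n - k)%N.
Proof.
move=> le_kn le_kr.
set E2 := fps_scale 2 (dexp lam 1 : fps R).
set d := fps_scale 2 (dexp_sub1_div_t ^+ (r - k)).
transitivity (n`!%:R * (d * (hermite_factor * (E2 - 1) ^+ k)) n).
  rewrite exchange_big fpsME mulr_sumr; apply: eq_bigr => /= l _.
  rewrite [E2 - 1]addrC [(- 1 + E2) ^+ k]exprDn [hermite_factor * _]mulr_sumr.
  rewrite fps_sumE !mulr_sumr; apply: eq_bigr => /= j _.
  rewrite horner_degHermite -/E2 [hermite_factor * (_ *+ _)]mulrnAr fps_mulrnE.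
  have -> (f : fps R) : hermite_factor * ((-1) ^+ (k - j) * f) =
      (-1) ^+ (k - j) * (hermite_factor * f) by rewrite mulrCA.
  have signE (f : fps R) i m : ((-1) ^+ i * f) m = (-1) ^+ i * f m.
    by rewrite -signr_odd -[in RHS]signr_odd !mulr_sign; case: odd.
  rewrite signE -addnBA // -[_ *+ 'C(_, _)]mulr_natl.
  have le_ln : (l <= n)%N by rewrite -ltnS.
  (* The factor l! goes with the Stirling number, (n - l)! with the Hermite polynomial. *)
  have -> : n`!%:R = 'C(n, l)%:R * (l`!%:R * (n - l)`!%:R) :> R.
    by rewrite -!natrM bin_fact.
  rewrite /d /fps_scale.
  have H := degStirling2_div_t l (r - k).
  transitivity (2 ^+ l * 'C(n, l)%:R * 'C(k, j)%:R
    * (degStirling2 lam (l + (r - k)) (r - k) / 'C(l + (r - k), l)%:R)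
    * (-1) ^+ (k - j) * ((n - l)`!%:R * (hermite_factor * E2 ^+ j) (n - l)%N)).
    by ring.
  by rewrite H; ring.
have E2E : E2 - 1 = fps_scale 2 ((fps_t : fps R) * dexp_sub1_div_t).
  by rewrite -dexp_sub1E /dexp_sub1 rmorphB rmorph1.
(* By k <= r, the powers q^k and q^(r-k) merge into q^r; the remaining (2t)^k gives 2^k and a degree
   shift by k. *)
rewrite E2E -rmorphXn mulrCA /d -rmorphM exprMn mulrCA -exprD subnK //.
rewrite rmorphM mulrCA rmorphXn /=.
have -> : fps_scale 2 fps_t = (fps_t : fps R) *+ 2.
  by apply/funext => i; rewrite fps_mulrnE /fps_scale; case: i => [|[|i]];
    rewrite ?mulr0 ?mul0rn // expr1 mulr1.
rewrite (exprMn_n (fps_t : fps R)) [_ *+ 2 ^ k * _]mulrnAl fps_mulrnE.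
rewrite -[in RHS](fps_mul_tXE (hermite_factor * _) k) subnKC //.
by rewrite -[_ *+ 2 ^ k]mulr_natl natrX mulrA.
Qed.

End HermiteBernoulli.

Unset Implicit Arguments.

Theorem theorem7 (R : realType) (lam : R) (hlam : lam != 0) (r n : nat)
    (hrn : (n < r)%N) :
  degHermite lam n =
  \sum_(k < n.+1)
     ((k`!%:R)^-1 *
      (\sum_(j < k.+1) \sum_(l < n.+1)
         (2 ^+ l * 'C(n, l)%:R * 'C(k, j)%:R) / 'C(l + r - k, l)%:R
         * degStirling2 lam (l + r - k) (r - k)
         * (-1) ^+ (k - j)
         * (degHermite lam (n - l)).[j%:R]))
     *: degBernoulli r lam k.
Proof.
(* The assumption n < r ensures that q^(r-k) is a genuine power for every k in the sum. *)
have le_kr (k : 'I_n.+1) : (k <= r)%N by rewrite (leq_trans _ hrn) // ltnW.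
under eq_bigr => k _.
  rewrite (degHermite_coord lam (ltn_ord k : (k <= n)%N) (le_kr k)).
  over.
(* The Cauchy product with B(2t) is compared term by term: its k-th factor is 2^k beta_k / k!. *)
rewrite {1}/degHermite (degHermite_gf_Bernoulli lam r) fpsME mulr_sumr.
apply: eq_bigr => k _; rewrite /degBernoulli /fps_scale /fps_map.
rewrite -!polyC_natr -polyC_exp -mul_polyC mulrCA.
rewrite -polyCM mulrAC [RHS]mulrA -!polyCM; congr (_%:P * _).
by field; rewrite factF_neq0.
Qed.
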